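(* Let $K$ be a field, let $X$ be a set equipped with a map $\deg: X \to \{1,2,3,\ldots\}$, and let $F = K\langle X\rangle = \bigoplus_{n\in\mathbb{Z}} F_n$ be the free associative unital $K$-algebra on $X$, with the $\mathbb{Z}$-grading induced by $\deg$. Let $R$ be a family (possibly with repetitions, of arbitrary cardinality) of homogeneous elements of $F$ of positive degree, with a map $\deg: R \to \{1,2,3,\ldots\}$ such that $r \in F_{\deg(r)}$ for each $r\in R$. Let $B = K\langle X \mid R\rangle = F/\mathfrak{r}$, where $\mathfrak{r}$ is the two-sided ideal of $F$ generated by the elements of $R$, with the induced $\mathbb{Z}$-grading $B = \bigoplus_{n\in\mathbb{Z}} B_n$, and set $\mathbf{b}_n := \dim_K(B_n)$ for each $n \in \mathbb{Z}$. Then, for every $n\in\mathbb{Z}$, $$\sum_{x\in X} \mathbf{b}_{n-\deg(x)} \;\le\; \Bigl(\sum_{r\in R} \mathbf{b}_{n-\deg(r)}\Bigr) + \mathbf{b}_n .$$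
   Context: The grading on $F$ has $F_n = \{0\}$ for $n<0$, $F_0=K$, and each $x\in X$ lies in $F_{\deg(x)}$. If an element of the family $R$ is the zero element of $F$, it is assigned some chosen positive finite degree. No cardinality restrictions are placed on $X$ or $R$: dimensions are cardinals, and the sums and the inequality are understood as those of (possibly infinite) cardinals. *)

(* Defs.v *)
From HB Require Import structures.
From mathcomp Require Import all_boot all_order all_algebra finmap.
From mathcomp Require Import boolp classical_sets functions cardinality.
From mathcomp.multinomials Require Import monalg.

Set Implicit Arguments.
Unset Strict Implicit.
Unset Printing Implicit Defensive.

Import Order.TTheory GRing.Theory Num.Theory.

Local Open Scope classical_set_scope.
Local Open Scope ring_scope.
Local Open Scope quotient_scope.

(* K<X>: the monoid algebra of the free monoid (words) on X. *)
Notation free_alg K X := {malg K[{fmonom X}]}.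

Section Grading.
Variables (K : fieldType) (X : choiceType) (degX : X -> nat).

Definition wdeg (w : {fmonom X}) : nat := (\sum_(x <- (w : seq X)) degX x)%N.

Definition free_gr (n : int) : set (free_alg K X) :=
  [set f | forall w, w \in msupp f -> (wdeg w)%:Z = n].

End Grading.

Section Ideal.
Variable A : pzRingType.

Definition two_sided_ideal (J : set A) : Prop :=
  [/\ J 0,
      forall a b, J a -> J b -> J (a + b) &
      forall a b, J b -> J (a * b) /\ J (b * a)].

Definition ideal_gen (I : Type) (r : I -> A) : set A :=
  smallest two_sided_ideal (range r).

Lemma ideal_gen_two_sided (I : Type) (r : I -> A) :
  two_sided_ideal (ideal_gen r).
Proof.
split=> [J [[J0 _ _] _]|a b Ja Jb J JP|a b Jb] //.
  by have [[_ JD _] _] := JP; apply: JD; [apply: Ja|apply: Jb].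
by split=> J JP; have [[_ _ JM] _] := JP; have [] := JM a b (Jb J JP).
Qed.

Definition ideal_gen_pred (I : Type) (r : I -> A) : {pred A} :=
  fun a => a \in ideal_gen r.

Lemma ideal_gen_predE (I : Type) (r : I -> A) a :
  (a \in ideal_gen_pred r) = (a \in ideal_gen r).
Proof. by []. Qed.

Lemma ideal_gen_zmod_closed (I : Type) (r : I -> A) :
  zmod_closed (ideal_gen_pred r).
Proof.
have [J0 JD JM] := ideal_gen_two_sided r.
split=> [|a b]; first by rewrite ideal_gen_predE inE.
rewrite !ideal_gen_predE !inE => Ja Jb; apply: JD => //.
by have [] := JM (-1) b Jb; rewrite mulN1r.
Qed.

HB.instance Definition _ (I : Type) (r : I -> A) :=
  GRing.isZmodClosed.Build A (ideal_gen_pred r) (ideal_gen_zmod_closed r).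

End Ideal.

(* K<X | R>: the quotient of K<X> by the two-sided ideal generated by the
   family r.  MathComp's ring_quotient provides the additive group of the
   quotient only, because K<X> is not commutative; the product and the scaling
   are added below.  The ring may be zero here (pzRingType), as r is
   arbitrary. *)
Definition pres_alg (K : fieldType) (X : choiceType) (I : Type)
    (r : I -> free_alg K X) : Type :=
  Quotient.quot (ideal_gen_pred r).

Section PresAlg.
Variables (K : fieldType) (X : choiceType) (I : Type).
Variable r : I -> free_alg K X.

Local Notation F := (free_alg K X).
Local Notation B := (pres_alg r).

HB.instance Definition _ := GRing.Zmodule.on B.

Definition pres_pi (f : F) : B := \pi_(Quotient.quot (ideal_gen_pred r)) f.
Definition pres_repr (b : B) : F :=
  repr (b : Quotient.quot (ideal_gen_pred r)).

Lemma pres_reprK : cancel pres_repr pres_pi.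
Proof. by move=> b; rewrite /pres_pi /pres_repr reprK. Qed.

Lemma pres_piE f g : (pres_pi f = pres_pi g) <-> ideal_gen r (f - g).
Proof.
rewrite -[ideal_gen r _]in_setE -ideal_gen_predE.
by split=> [/eqP|H]; [|apply/eqP]; rewrite -?Quotient.idealrBE // Quotient.idealrBE.
Qed.

Lemma pres_piD : {morph pres_pi : f g / f + g}.
Proof. by move=> f g; rewrite /pres_pi Quotient.pi_add. Qed.

Definition pres_one : B := pres_pi 1.
Definition pres_mul (a b : B) : B := pres_pi (pres_repr a * pres_repr b).
Definition pres_scale (k : K) (b : B) : B := pres_pi (k *: pres_repr b).

Lemma pres_repr_pi f : ideal_gen r (pres_repr (pres_pi f) - f).
Proof. by apply/pres_piE; rewrite pres_reprK. Qed.

Lemma pres_piM f g : pres_mul (pres_pi f) (pres_pi g) = pres_pi (f * g).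
Proof.
have [_ JD JM] := ideal_gen_two_sided r.
apply/pres_piE; set f' := pres_repr _; set g' := pres_repr _.
have -> : f' * g' - f * g = (f' - f) * g' + f * (g' - g).
  by rewrite mulrBl mulrBr addrA subrK.
by apply: JD; [apply: (JM _ _ _).2|apply: (JM _ _ _).1]; apply: pres_repr_pi.
Qed.

Lemma pres_piZ k f : pres_scale k (pres_pi f) = pres_pi (k *: f).
Proof.
have [_ JD JM] := ideal_gen_two_sided r.
apply/pres_piE; rewrite -scalerBr -mul_malgC.
by apply: (JM _ _ _).1; apply: pres_repr_pi.
Qed.

Lemma pres_ind (P : B -> Prop) : (forall f, P (pres_pi f)) -> forall b, P b.
Proof. by move=> HP b; rewrite -[b]pres_reprK. Qed.

Lemma pres_mulA : associative pres_mul.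
Proof.
elim/pres_ind=> f; elim/pres_ind=> g; elim/pres_ind=> h.
by rewrite !pres_piM mulrA.
Qed.

Lemma pres_mul1 : left_id pres_one pres_mul.
Proof. by elim/pres_ind=> f; rewrite pres_piM mul1r. Qed.

Lemma pres_mulr1 : right_id pres_one pres_mul.
Proof. by elim/pres_ind=> f; rewrite pres_piM mulr1. Qed.

Lemma pres_mulDl : left_distributive pres_mul +%R.
Proof.
elim/pres_ind=> f; elim/pres_ind=> g; elim/pres_ind=> h.
by rewrite -pres_piD !pres_piM mulrDl pres_piD.
Qed.

Lemma pres_mulDr : right_distributive pres_mul +%R.
Proof.
elim/pres_ind=> f; elim/pres_ind=> g; elim/pres_ind=> h.
by rewrite -pres_piD !pres_piM mulrDr pres_piD.
Qed.

HB.instance Definition _ := GRing.Zmodule_isPzRing.Build B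
  pres_mulA pres_mul1 pres_mulr1 pres_mulDl pres_mulDr.

Lemma pres_scaleA a b v :
  pres_scale a (pres_scale b v) = pres_scale (a * b) v.
Proof. by elim/pres_ind: v => f; rewrite !pres_piZ scalerA. Qed.

Lemma pres_scale1 : left_id 1 pres_scale.
Proof. by elim/pres_ind=> f; rewrite pres_piZ scale1r. Qed.

Lemma pres_scaleDr : right_distributive pres_scale +%R.
Proof.
move=> a; elim/pres_ind=> f; elim/pres_ind=> g.
by rewrite -pres_piD !pres_piZ scalerDr pres_piD.
Qed.

Lemma pres_scaleDl v : {morph pres_scale^~ v : a b / a + b}.
Proof.
by move=> a b; elim/pres_ind: v => f; rewrite !pres_piZ scalerDl pres_piD.
Qed.

HB.instance Definition _ := GRing.Zmodule_isLmodule.Build K B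
  pres_scaleA pres_scale1 pres_scaleDr pres_scaleDl.

Lemma pres_scalerAl (k : K) (a b : B) : k *: (a * b) = (k *: a) * b.
Proof.
elim/pres_ind: a => f; elim/pres_ind: b => g.
change (pres_scale k (pres_mul (pres_pi f) (pres_pi g)) =
  pres_mul (pres_scale k (pres_pi f)) (pres_pi g)).
by rewrite pres_piM !pres_piZ pres_piM scalerAl.
Qed.

Lemma pres_scalerAr (k : K) (a b : B) : k *: (a * b) = a * (k *: b).
Proof.
elim/pres_ind: a => f; elim/pres_ind: b => g.
change (pres_scale k (pres_mul (pres_pi f) (pres_pi g)) =
  pres_mul (pres_pi f) (pres_scale k (pres_pi g))).
rewrite pres_piM !pres_piZ pres_piM; congr pres_pi.
have fk : f * k%:MP = k%:MP * f.
  rewrite !malgM_def fgmulgU fgmulUg; apply: eq_bigr => w _.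
  by rewrite mulm1 mul1m mulrC.
by rewrite -[k *: g]mul_malgC mulrA fk -mulrA mul_malgC.
Qed.

Definition pres_gr (degX : X -> nat) (n : int) : set B :=
  pres_pi @` free_gr degX n.

End PresAlg.

Arguments pres_gr {K X I} r degX n.

Section Dimension.
Variables (K : fieldType) (V : lmodType K).

Definition lin_indep (T : Type) (e : T -> V) : Prop :=
  forall (m : nat) (t : 'I_m -> T), injective t ->
  forall c : 'I_m -> K, \sum_(i < m) c i *: e (t i) = 0 -> forall i, c i = 0.

Definition spans (T : Type) (e : T -> V) (W : set V) : Prop :=
  forall v, W v -> exists (m : nat) (t : 'I_m -> T) (c : 'I_m -> K),
    v = \sum_(i < m) c i *: e (t i).

(* Cardinals are represented by types, up to bijection: [has_dim W T] says
   that the dimension of the subspace W is the cardinal of T. *)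
Definition has_dim (W : set V) (T : Type) : Prop :=
  exists e : T -> V, [/\ forall t, W (e t), lin_indep e & spans e W].

Lemma exists_has_dim (W : set V) : exists T : Type, has_dim W T.
Proof.
pose free (S : set V) := forall m (t : 'I_m -> V), injective t ->
  (forall i, S (t i)) -> forall c : 'I_m -> K,
  \sum_(i < m) c i *: t i = 0 -> forall i, c i = 0.
have [|S [[SW Sf] Smax]] := @Zorn_bigcup V [set S | S `<=` W /\ free S].
  move=> G GP Gtot; split=> [v [S /GP[SW _]] /SW //|m t tI tG].
  suff [m0|[S [GS tS]]] : m = 0%N \/ exists S, G S /\ forall i, S (t i).
  - by move=> c _ [i lim]; exfalso; move: lim; rewrite m0.
  - by have [_] := GP _ GS; exact.
  elim: m t {tI} tG => [|m IHm] t tG; [by left|right].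
  have [S GS t0] := tG ord0.
  have [m0|[S' [GS' tS']]] := IHm (fun i => t (lift ord0 i)) (fun i => tG _).
    by exists S; split=> // i; subst m; rewrite (ord1 i).
  have [SS'|S'S] := Gtot _ _ GS GS'.
  - exists S'; split=> // i; case: (unliftP ord0 i) => [j ->|->] //.
    exact: SS'.
  - exists S; split=> // i; case: (unliftP ord0 i) => [j ->|->] //.
    exact: S'S.
exists {v | S v}, sval; split=> [[v /SW] //|m t tI c|v Wv].
  apply: Sf => [i j|i]; last exact: svalP.
  move=> /eqP/= tij; apply: tI; move: tij.
  case: (t i) (t j) => [u Su] [w Sw] /= /eqP uw.
  by subst w; congr exist; exact: Prop_irrelevance.
have [Sv|Sv] := pselect (S v).
  exists 1%N, (fun=> exist _ v Sv), (fun=> 1).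
  by rewrite big_ord1 scale1r.
have /contrapT : ~ ~ exists (m : nat) (t : 'I_m -> V) (c : 'I_m -> K),
    (forall i, S (t i)) /\ v = \sum_(i < m) c i *: t i.
  move=> nspan; apply: (Smax (S `|` [set v])).
    by split=> [u|/(_ v (or_intror erefl))]; [left|].
  split=> [u [/SW //|->] //|m t tI tS c ct0].
  have [tSS|] := pselect (forall i, S (t i)); first exact: Sf tI tSS c ct0.
  move=> /existsNP[i0 nS0]; have t0 : t i0 = v by case: (tS i0).
  case: m i0 t tI tS c ct0 nS0 t0 => [[]//|m] i0 t tI tS c + nS0 t0.
  have tS' j : S (t (lift i0 j)).
    case: (tS (lift i0 j)) => // tj; have /tI/eqP : t (lift i0 j) = t i0.
      by rewrite t0.
    by rewrite eq_sym (negPf (neq_lift _ _)).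
  rewrite (bigD1_ord i0) //= t0 => ct0.
  have c0 : c i0 = 0.
    apply: contrapT => /eqP c0; apply: nspan.
    exists m, (fun j => t (lift i0 j)), (fun j => - (c i0)^-1 * c (lift i0 j)).
    split=> //; rewrite (eq_bigr (fun j =>
      - (c i0)^-1 *: (c (lift i0 j) *: t (lift i0 j)))); last first.
      by move=> j _; rewrite scalerA.
    rewrite -scaler_sumr -[v in LHS]scale1r -(mulVf c0) -scalerA scaleNr.
    by rewrite -scalerN; congr (_ *: _); apply/eqP; rewrite -addr_eq0 ct0.
  move=> i; case: (unliftP i0 i) => [j ->|->] //.
  apply: (Sf m (fun j => t (lift i0 j)) _ tS' (fun j => c (lift i0 j))).
    by move=> ? ? /tI/lift_inj.
  by move: ct0; rewrite c0 scale0r add0r.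
move=> [m [t [c [tS ->]]]].
by exists m, (fun i => exist _ (t i) (tS i)), c.
Qed.

End Dimension.

(* Main.v *)
Require Import Defs.
From mathcomp Require Import all_boot all_order all_algebra finmap.
From mathcomp Require Import boolp classical_sets functions cardinality wochoice.
From mathcomp.multinomials Require Import monalg.

(** Every element of the augmentation ideal of [F] is uniquely a sum of [f_x * x],
    and right derivation [f |-> (f_x mod r)_x] turns the start of the standard
    resolution of the trivial module into the exact sequence of left modules
      (+)_i B(-deg r_i) --> (+)_x B(-deg x) --> B.
    Exactness in the middle holds because the ideal is spanned by the products
    [a * r_i * c] of words [a, c] with relators: if [c] is nontrivial, ending in
    the generator [x], the derivative is the image of an element of the ideal,
    hence zero, and if [c = 1] it is [a] times the derivative of [r_i].  In
    degree [n] the free family [e_t x] of the middle term is thus spanned by the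
    [e_t * d(r_i)] together with one lift of each basis vector of [B_n].  That a
    free family is no larger than a spanning one is proved without cardinal
    arithmetic, by a transfinite Gaussian elimination. *)

Set Implicit Arguments.
Unset Strict Implicit.
Unset Printing Implicit Defensive.

Import GRing.Theory.

Local Open Scope classical_set_scope.
Local Open Scope card_scope.
Local Open Scope ring_scope.

(** * Strict well-orders on arbitrary types *)

Lemma exists_strict_well_order (T : Type) :
  exists lt : T -> T -> Prop,
  [/\ forall x, ~ lt x x,
      forall x y z, lt x y -> lt y z -> lt x z,
      forall x y, [\/ lt x y, x = y | lt y x] &
      forall P : set T, P !=set0 -> exists2 m, P m & forall y, P y -> ~ lt y m].
Proof.
have [le le_wo] := well_ordering_principle {classic T}.
have le_chain : wo_chain le [pred _ | true] by move=> A _; apply: le_wo.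
have le_total x y : le x y || le y x by apply: (wo_chainW le_chain).
have le_anti x y : le x y -> le y x -> x = y.
  by move=> lxy lyx; apply: (wo_chain_antisymmetric le_chain); rewrite ?lxy.
(* Transitivity comes from the least element [m] of the three: if it is [x] the claim is immediate,
   otherwise antisymmetry identifies two of them. *)
have le_trans x y z : le x y -> le y z -> le x z.
  move=> lxy lyz; have [|m [[mA mmin] _]] := le_wo [pred u | u \in [:: x; y; z]].
    by exists x; rewrite !inE eqxx.
  have mz : le m z by apply: mmin; rewrite !inE eqxx !orbT.
  have my : le m y by apply: mmin; rewrite !inE eqxx !orbT.
  have mx : le m x by apply: mmin; rewrite !inE eqxx.
  move: mA; rewrite !inE => /or3P[] /eqP ?; subst m => //.
  - by rewrite (le_anti _ _ lxy mx).
  - by rewrite -(le_anti _ _ lyz my).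
exists (fun x y => le x y /\ x <> y); split.
- by move=> x [].
- move=> x y z [lxy xy] [lyz yz]; split; first exact: le_trans lyz.
  by move=> xz; subst z; apply: xy; apply: le_anti.
- move=> x y; have [->|xy] := pselect (x = y); first exact: Or32.
  have /orP[lxy|lyx] := le_total x y; first exact: Or31.
  by apply: Or33; split=> // yx; apply: xy.
- move=> P [x Px]; have [|m [[Pm mmin] _]] := le_wo (fun u => `[< P u >]).
    by exists x; apply/asboolP.
  exists m => [|y Py [lym ym]]; first exact/asboolP.
  by apply: ym; apply: le_anti => //; apply: mmin; apply/asboolP.
Qed.

(** * Spans and free families *)

Section Span.
Variables (K : fieldType) (V : lmodType K).
Implicit Types (S U : set V) (u v w : V).

Definition subspace U : Prop :=
  [/\ U 0, forall u v, U u -> U v -> U (u + v) & forall k u, U u -> U (k *: u)].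

(** Taken as an intersection, so that a property of the span is proved by showing that it cuts out a
    subspace containing [S]. *)
Definition span S : set V := smallest subspace S.

Lemma span_subspace S : subspace (span S).
Proof.
split=> [U [[]] //|u v Su Sv U PU|k u Su U PU].
- by have [[_ UD _] _] := PU; apply: UD; [apply: Su|apply: Sv].
- by have [[_ _ UZ] _] := PU; apply: UZ; apply: Su.
Qed.

Lemma sub_span S : S `<=` span S. Proof. exact: sub_smallest. Qed.

Lemma span_min S U : subspace U -> S `<=` U -> span S `<=` U.
Proof. exact: smallest_sub. Qed.

Lemma span_sub S S' : S `<=` S' -> span S `<=` span S'.
Proof.
move=> SS'; apply: span_min; first exact: span_subspace.
by move=> v /SS'; exact: sub_span.
Qed.

Section SubspaceTheory.
Variables (U : set V) (Usub : subspace U).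

Lemma subspace0 : U 0. Proof. by case: Usub. Qed.
Lemma subspaceD u v : U u -> U v -> U (u + v).
Proof. by case: Usub => _ + _; exact. Qed.
Lemma subspaceZ k u : U u -> U (k *: u).
Proof. by case: Usub => _ _; exact. Qed.
Lemma subspaceB u v : U u -> U v -> U (u - v).
Proof.
by move=> Uu Uv; rewrite -scaleN1r; apply: subspaceD => //; apply: subspaceZ.
Qed.
Lemma subspace_sum (I : Type) (s : seq I) (P : pred I) (F : I -> V) :
  (forall i, P i -> U (F i)) -> U (\sum_(i <- s | P i) F i).
Proof. by move=> UF; apply: big_ind => //; [apply: subspace0|apply: subspaceD]. Qed.
End SubspaceTheory.

Lemma span_setU1 S u v :
  span (S `|` [set u]) v -> exists a, span S (v - a *: u).
Proof.
have Ssub := span_subspace S.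
apply: (@span_min _ [set v | exists a, span S (v - a *: u)]).
  split=> [|v1 v2 [a1 S1] [a2 S2]|k v1 [a S1]].
  - by exists 0; rewrite scale0r subr0; apply: (subspace0 Ssub).
  - by exists (a1 + a2); rewrite scalerDl opprD addrACA; apply: (subspaceD Ssub).
  - by exists (k * a); rewrite -scalerA -scalerBr; apply: (subspaceZ Ssub).
move=> w [Sw|->].
  by exists 0; rewrite scale0r subr0; apply: sub_span.
by exists 1; rewrite scale1r subrr; apply: (subspace0 Ssub).
Qed.

(* Only finitely many members of a family occur in a linear combination, so one
   of them is the last. *)
Lemma span_below (T : Type) (lt : T -> T -> Prop) (s : T -> V) (A : set T) v :
  (forall x y z, lt x y -> lt y z -> lt x z) ->
  (forall x y, [\/ lt x y, x = y | lt y x]) ->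
  span (s @` A) v -> v = 0 \/
  exists2 t, A t & span (s @` [set t' | lt t' t \/ t' = t]) v.
Proof.
move=> lt_trans lt_total.
pose below t := span (s @` [set t' | lt t' t \/ t' = t]).
have below_sub t : subspace (below t) by exact: span_subspace.
have belowS t t' : lt t t' -> below t `<=` below t'.
  move=> tt'; apply: span_sub => _ [u ut <-]; exists u => //; left.
  by case: ut => [ut|->] //; apply: lt_trans tt'.
(* The case [v = 0] is kept apart because [A] may be empty. For a sum, the larger of the two indices
   serves, by [belowS]. *)
apply: (@span_min _ [set v | v = 0 \/ exists2 t, A t & below t v]).
  split=> [|v1 v2|k v1]; first by left.
  - case=> [->|[t1 A1 S1]]; first by rewrite add0r.
    case=> [->|[t2 A2 S2]]; first by rewrite addr0; right; exists t1.
    right; have [t12|t12|t21] := lt_total t1 t2.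
    + exists t2 => //; apply: (subspaceD (below_sub _)) => //.
      by apply: belowS t12 _ _.
    + by subst t2; exists t1 => //; apply: (subspaceD (below_sub _)).
    + exists t1 => //; apply: (subspaceD (below_sub _)) => //.
      by apply: belowS t21 _ _.
  - case=> [->|[t A1 S1]]; first by left; rewrite scaler0.
    by right; exists t => //; apply: (subspaceZ (below_sub _)).
move=> _ [t At <-]; right; exists t => //.
by apply: sub_span; exists t => //; right.
Qed.

(** Freeness without coefficients. It forces [e] to be injective, since a repeated vector would lie
    in the span of the others. *)
Definition free_family (T : Type) (e : T -> V) : Prop :=
  forall t, ~ span (e @` [set t' | t' <> t]) (e t).

(* Well-order both index sets, and call [l] a leading index of [U] when [U]
   contains [e l] plus a combination of earlier members of [e].  Adjoining one
   vector to [U] adds at most one leading index, so sending [l] to the first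
   [t] at which [l] leads the span of [s t'], [t' <= t], is injective. *)
Lemma free_family_card_le (T1 T2 : Type) (e : T1 -> V) (s : T2 -> V) :
  free_family e -> (forall l, span (range s) (e l)) ->
  [set: T1] #<= [set: T2].
Proof.
move=> e_free e_span.
have [lt1 [lt1_irr lt1_trans lt1_total _]] := exists_strict_well_order T1.
have [lt2 [lt2_irr lt2_trans lt2_total lt2_min]] := exists_strict_well_order T2.
pose low l := span (e @` [set l' | lt1 l' l]).
have low_sub l : subspace (low l) by exact: span_subspace.
pose leads (U : set V) l := exists2 v, U v & low l (v - e l).
pose upto t := span (s @` [set t' | lt2 t' t \/ t' = t]).
pose before t := span (s @` [set t' | lt2 t' t]).
have leads0 l v : low l (v - e l) -> v <> 0.
  move=> + v0; rewrite v0 sub0r => lowl; apply: (e_free l).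
  have: low l (e l) by rewrite -[e l]opprK -scaleN1r; apply: (subspaceZ (low_sub _)).
  apply: span_sub => _ [l' l'l <-]; exists l' => // ll'.
  by move: l'l; rewrite /= ll'; apply: lt1_irr.
(* Some [t] works because [e l] itself lies in some [upto t]. At the least such [t], a leading
   vector in [before t] would already lie in [upto t'] for an earlier [t']. *)
have first_lead l : exists t, leads (upto t) l /\ ~ leads (before t) l.
  have [t [v Uv lowv] tmin] : exists2 t, leads (upto t) l &
      forall t', leads (upto t') l -> ~ lt2 t' t.
    apply: lt2_min; have lowel : low l (e l - e l).
      by rewrite subrr; apply: (subspace0 (low_sub _)).
    have [el0|[t _ tel]] := span_below lt2_trans lt2_total (e_span l).
      by have := leads0 _ _ lowel el0.
    by exists t, (e l).
  exists t; split=> [|[w Uw loww]]; first by exists v.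
  have [w0|[t' t't Ut'w]] := span_below lt2_trans lt2_total Uw.
    exact: leads0 loww w0.
  by apply: tmin t't; exists w.
have [f fP] := choice first_lead.
(* If both indices first lead at the same [t], subtract from [w] the multiple of [v] that cancels
   [s t]. The result lies in [before t] and still leads at [l'], because [v] only involves members
   of [e] up to [l], hence before [l']. *)
have f_lt l l' : lt1 l l' -> f l <> f l'.
  move=> ll' fll'; have [[v Uv lowv] nv] := fP l; have [[w Uw loww] nw] := fP l'.
  have uptoE t : upto t `<=` span ((s @` [set t' | lt2 t' t]) `|` [set s t]).
    by apply: span_sub => _ [t' [t't|->] <-]; [left; exists t'|right].
  have [a va] := span_setU1 (uptoE _ _ Uv).
  have [c wc] := span_setU1 (uptoE _ _ Uw).
  have before_sub t : subspace (before t) by exact: span_subspace.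
  have a0 : a != 0.
    apply/eqP=> a0; apply: nv; exists v => //.
    by move: va; rewrite a0 scale0r subr0.
  apply: nw; exists (w - (c / a) *: v).
    have -> : w - (c / a) *: v =
        (w - c *: s (f l')) - (c / a) *: (v - a *: s (f l)).
      by rewrite scalerBr scalerA divfK // fll' opprB addrA subrK.
    apply: (subspaceB (before_sub _)) => //; apply: (subspaceZ (before_sub _)).
    by rewrite -fll'.
  have -> : w - (c / a) *: v - e l' =
      (w - e l') - ((c / a) *: (v - e l) + (c / a) *: e l).
    by rewrite -scalerDr subrK addrAC.
  apply: (subspaceB (low_sub _)) => //; apply: (subspaceD (low_sub _));
    apply: (subspaceZ (low_sub _)).
    by apply: span_sub lowv => _ [k kl <-]; exists k => //; apply: lt1_trans ll'.
  by apply: sub_span; exists l.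
have f_inj : {in [set: T1] &, injective f}.
  move=> l l' _ _ ff; have [ll'|//|l'l] := lt1_total l l'.
    by have := f_lt _ _ ll' ff.
  by have := f_lt _ _ l'l (esym ff).
have /card_eqPle[_ le1] := inj_card_eq f_inj.
by apply: card_le_trans le1 _; apply: subset_card_le.
Qed.

(** Recovers explicit coefficients from the span. The type [{classic T}] supplies the decidable
    equality on indices that [uniq] needs. *)
Lemma span_combination (T : Type) (e : T -> V) (A : set T) v :
  span (e @` A) v -> exists (s : seq {classic T}) (c : T -> K),
    [/\ uniq s, forall t, t \in s -> A t & v = \sum_(t <- s) c t *: e t].
Proof.
pose comb v := exists (s : seq {classic T}) (c : T -> K),
    [/\ uniq s, forall t, t \in s -> A t & v = \sum_(t <- s) c t *: e t].
apply: (@span_min _ comb); last first.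
  move=> _ [t At <-]; exists [:: t : {classic T}], (fun=> 1).
  by split=> // [u|]; [rewrite inE => /eqP->|rewrite big_seq1 scale1r].
split=> [|v1 v2|k v1]; first by exists [::], (fun=> 0); rewrite big_nil.
  move=> [s1 [c1 [s1u s1A ->]]] [s2 [c2 [s2u s2A ->]]].
  pose s := undup (s1 ++ s2).
  (* Padding with zero coefficients brings both combinations to the common support [s]. *)
  have extend (s' : seq {classic T}) (c : T -> K) : uniq s' -> {subset s' <= s} ->
      \sum_(t <- s') c t *: e t =
      \sum_(t <- s) (if t \in s' then c t else 0) *: e t.
    move=> s'u s's; transitivity (\sum_(t <- s | t \in s') c t *: e t).
      rewrite -[RHS]big_filter; apply: perm_big; apply: uniq_perm => //.
        by rewrite filter_uniq ?undup_uniq.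
      move=> t; rewrite mem_filter.
      by case ts': (t \in s') => //=; rewrite s's.
    rewrite big_mkcond; apply: eq_bigr => t _.
    by case: ifP; rewrite ?scale0r.
  exists s, (fun t => (if (t : {classic T}) \in s1 then c1 t else 0) +
                      (if (t : {classic T}) \in s2 then c2 t else 0)).
  split; first exact: undup_uniq.
    by move=> t; rewrite mem_undup mem_cat => /orP[/s1A|/s2A].
  rewrite (extend s1) ?(extend s2) //.
  - by rewrite -big_split; apply: eq_bigr => t _; rewrite scalerDl.
  - by move=> t ts; rewrite mem_undup mem_cat ts orbT.
  - by move=> t ts; rewrite mem_undup mem_cat ts.
move=> [s [c [su sA ->]]]; exists s, (fun t => k * c t); split=> //.
by rewrite scaler_sumr; apply: eq_bigr => t _; rewrite scalerA.
Qed.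

(** An expression of [e t] through other members becomes a linear relation in which [e t] has
    coefficient -1. *)
Lemma lin_indep_free_family (T : Type) (e : T -> V) :
  lin_indep e -> free_family e.
Proof.
move=> e_indep t /span_combination[s [c [su sA et]]].
pose s' := (t : {classic T}) :: s.
have s'u : uniq s' by rewrite /= su andbT; apply/negP => /sA; apply.
pose c' (u : {classic T}) := if u == t then -1 else c u.
have nth_inj : injective (fun i : 'I_(size s') => nth t s' i).
  move=> i j ij; apply/ord_inj/eqP.
  by rewrite -(nth_uniq (t : {classic T}) _ _ s'u) //; apply/eqP.
have sum0 : \sum_(i < size s') c' (nth t s' i) *: e (nth t s' i) = 0.
  rewrite -(big_mkord xpredT (fun i => c' (nth t s' i) *: e (nth t s' i))).
  rewrite -(big_nth (t : {classic T}) xpredT (fun u : {classic T} => c' u *: e u)).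
  rewrite big_cons /c' eqxx scaleN1r.
  apply/eqP; rewrite addrC subr_eq0 et; apply/eqP.
  rewrite !big_seq; apply: eq_bigr => u /sA ut.
  by rewrite ifN //; apply/eqP.
have /eqP := e_indep _ _ nth_inj (fun i => c' (nth t s' i)) sum0 ord0.
by rewrite /c' /= eqxx oppr_eq0 oner_eq0.
Qed.

End Span.

(** * Linear maps and subspaces *)

Section LinearMaps.
Variables (K : fieldType) (V W : lmodType K).

Lemma linear_fun0 (g : V -> W) : linear g -> g 0 = 0.
Proof.
by move=> g_lin; have := g_lin (-1) 0 0; rewrite scaler0 addr0 scaleN1r addNr.
Qed.

Lemma subspace_preimage (g : V -> W) (U : set W) :
  linear g -> subspace U -> subspace (g @^-1` U).
Proof.
move=> g_lin Usub.
have g0 := linear_fun0 g_lin.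
split=> [|u v Uu Uv|k u Uu] /=; first by rewrite g0; apply: (subspace0 Usub).
  by rewrite -[u]scale1r g_lin scale1r; apply: (subspaceD Usub).
by rewrite -[k *: u]addr0 g_lin g0 addr0; apply: (subspaceZ Usub).
Qed.

(** Together with [span_min], this reduces an identity between linear maps to a check on
    generators. *)
Lemma subspace_equalizer (g h : V -> W) :
  linear g -> linear h -> subspace [set v | g v = h v].
Proof.
move=> g_lin h_lin.
have g0 := linear_fun0 g_lin.
have h0 := linear_fun0 h_lin.
split=> [|u v /= ghu ghv|k u /= ghu]; first by rewrite /= g0 h0.
  by rewrite -[u]scale1r g_lin h_lin ghu ghv.
by rewrite -[k *: u]addr0 g_lin h_lin ghu g0 h0.
Qed.

End LinearMaps.

Lemma spans_span (K : fieldType) (V : lmodType K) (T : Type) (e : T -> V) W :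
  spans e W -> W `<=` span (range e).
Proof.
move=> e_spans v /e_spans[m [t [c ->]]].
have Ssub := span_subspace (range e).
apply: (subspace_sum Ssub) => i _; apply: (subspaceZ Ssub).
by apply: sub_span; exists (t i).
Qed.

(** * Linear maps on the free algebra *)

Section MalgLinear.
Variables (K : fieldType) (W : choiceType).
Local Notation F := {malg K[W]}.

Lemma malg_span (f : F) :
  span ((fun w => << w >> : F) @` [set w | w \in msupp f]) f.
Proof.
rewrite {2}[f]monalgE big_seq; set S := span _.
have Ssub : subspace S by exact: span_subspace.
apply: (subspace_sum Ssub) => w wf.
have -> : << f@_w *g w >> = f@_w *: (<< w >> : F).
  by apply/malgP => u; rewrite mcoeffZ !mcoeffU mulrnAr mulr1.
by apply: (subspaceZ Ssub); apply: sub_span; exists w.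
Qed.

Variable (V : lmodType K).

Definition malg_lift (g : W -> V) (f : F) : V :=
  \sum_(w <- msupp f) f@_w *: g w.

Lemma malg_liftEw (g : W -> V) (d : {fset W}) (f : F) : (msupp f `<=` d)%fset ->
  malg_lift g f = \sum_(w <- d) f@_w *: g w.
Proof.
move=> fd; rewrite [LHS](big_fset_incl _ fd) => //= w _ /mcoeff_outdom ->.
by rewrite scale0r.
Qed.

Lemma malg_liftU (g : W -> V) w : malg_lift g << w >> = g w.
Proof. by rewrite (malg_liftEw _ msuppU_le) big_seq_fset1 mcoeffUU scale1r. Qed.

Lemma malg_lift_linear (g : W -> V) : linear (malg_lift g).
Proof.
move=> k f1 f2; pose d := (msupp (k *: f1 + f2) `|` (msupp f1 `|` msupp f2))%fset.
have f1d : (msupp f1 `<=` d)%fset.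
  by apply: fsubset_trans (fsubsetUr _ _); apply: fsubsetUl.
have f2d : (msupp f2 `<=` d)%fset.
  by apply: fsubset_trans (fsubsetUr _ _); apply: fsubsetUr.
rewrite (malg_liftEw g (fsubsetUl _ _ : (_ `<=` d)%fset)).
rewrite (malg_liftEw g f1d) (malg_liftEw g f2d) scaler_sumr -big_split.
by apply: eq_bigr => w _; rewrite mcoeffD mcoeffZ scalerDl scalerA.
Qed.

End MalgLinear.

Local Notation "1" := (@mone _) : monom_scope.
Local Notation "x * y" := (mmul x y) : monom_scope.

Arguments malg_span {K W} f.

(** * Words, grading and two-sided ideals in the free algebra *)

Section FreeAlgebra.
Variables (K : fieldType) (X : choiceType) (degX : X -> nat).
Local Notation F := (free_alg K X).
Local Notation gr := (@free_gr K X degX).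
Implicit Types (f g : F) (w : {fmonom X}).

Lemma mul_wordE w1 w2 : << w1 >> * << w2 >> = << (w1 * w2)%M >> :> F.
Proof. by rewrite malgM_def fgmulUU mulr1. Qed.

Lemma mul_malg_scaler f (k : K) g : f * (k *: g) = k *: (f * g).
Proof.
rewrite -!mul_malgC mulrA; suff -> : f * k%:MP = k%:MP * f by rewrite mulrA.
rewrite !malgM_def fgmulgU fgmulUg; apply: eq_bigr => w _.
by rewrite mulm1 mul1m mulrC.
Qed.

Lemma mulr_malg_linear f : linear (fun g => f * g).
Proof. by move=> k g h; rewrite mulrDr mul_malg_scaler. Qed.

Lemma mull_malg_linear f : linear (fun g => g * f).
Proof. by move=> k g h; rewrite mulrDl -scalerAl. Qed.

Lemma fmonom_last w : w = 1%M \/ exists w' x, w = (w' * fmu x)%M.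
Proof.
case: w; elim/last_ind=> [|s x _]; [left|right]; first by apply/eqP; rewrite fmP fm1.
by exists (FMonom s), x; apply/eqP; rewrite fmP fmM fmU cats1.
Qed.

Lemma wdeg1 : wdeg degX 1%M = 0%N.
Proof. by rewrite /wdeg fm1 big_nil. Qed.

Lemma wdegM w1 w2 : wdeg degX (w1 * w2)%M = (wdeg degX w1 + wdeg degX w2)%N.
Proof. by rewrite /wdeg fmM big_cat. Qed.

Lemma wdegU x : wdeg degX (fmu x) = degX x.
Proof. by rewrite /wdeg fmU big_seq1. Qed.

Lemma free_gr_subspace n : subspace (gr n).
Proof.
split=> [w|f g Ff Fg w|k f Ff w]; first by rewrite msupp0 in_fset0.
  move=> /(fsubsetP (msuppD_le _ _)); rewrite in_fsetU.
  by case/orP=> [/Ff|/Fg].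
by move=> /(fsubsetP (msuppZ_le _ _)) /Ff.
Qed.

Lemma free_gr_word w : gr (wdeg degX w)%:Z << w >>.
Proof. by move=> u; rewrite msuppU1 in_fset1 => /eqP->. Qed.

Lemma free_gr_span n f : gr n f ->
  span ((fun w => << w >> : F) @` [set w | (wdeg degX w)%:Z = n]) f.
Proof.
move=> Ff; apply: span_sub (malg_span f) => _ [w /Ff wn <-].
by exists w.
Qed.

Lemma free_grM m n f g : gr m f -> gr n g -> gr (m + n) (f * g).
Proof.
move=> /free_gr_span Ff /free_gr_span Fg; have Gsub := free_gr_subspace (m + n).
apply: (span_min (subspace_preimage (mull_malg_linear g) Gsub)) Ff.
move=> _ [w1 w1m <-] /=.
apply: (span_min (subspace_preimage (mulr_malg_linear _) Gsub)) Fg.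
move=> _ [w2 w2n <-] /=.
by rewrite mul_wordE -w1m -w2n -PoszD -wdegM; apply: free_gr_word.
Qed.

Definition free_comp (n : int) : F -> F :=
  malg_lift (fun w => if (wdeg degX w)%:Z == n then << w >> else 0).

Lemma free_comp_linear n : linear (free_comp n).
Proof. exact: malg_lift_linear. Qed.

Lemma free_comp_gr m n f : gr m f -> free_comp n f = if m == n then f else 0.
Proof.
move=> /free_gr_span.
have lin : linear (fun f => if m == n then f else 0 : F).
  by move=> k f1 f2; case: ifP => // _; rewrite scaler0 addr0.
apply: (span_min (subspace_equalizer (free_comp_linear n) lin)).
by move=> _ [w <- <-] /=; rewrite /free_comp malg_liftU.
Qed.

Lemma ideal_gen_span (I : Type) (r : I -> F) :
  ideal_gen r `<=` span [set f | exists a i c, f = << a >> * r i * << c >>].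
Proof.
set S := span _; have Ssub : subspace S by exact: span_subspace.
(* Quantifying over both outer words makes [J] a two-sided ideal: a further factor, reduced to words
   by linearity, is absorbed into [a] or [c]. *)
pose J := [set f | forall a c, S (<< a >> * f * << c >>)].
suff Jgen : ideal_gen r `<=` J.
  move=> f /Jgen /(_ 1%M 1%M).
  by rewrite -[<< 1%M >>]/(1 : F) mul1r mulr1.
apply: smallest_sub; last first.
  by move=> _ [i _ <-] a c; apply: sub_span; exists a, i, c.
split=> [a c|f g Jf Jg a c|g f Jf].
- by rewrite mulr0 mul0r; apply: (subspace0 Ssub).
- by rewrite mulrDr mulrDl; apply: (subspaceD Ssub).
split=> a c.
  have lin : linear (fun h => << a >> * (h * f) * << c >>).
    move=> k h1 h2.
    by rewrite !(mulrDl, mulrDr) -!scalerAl mul_malg_scaler -!scalerAl.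
  apply: (span_min (subspace_preimage lin Ssub)) (malg_span g).
  by move=> _ [w _ <-] /=; rewrite mulrA mul_wordE; apply: Jf.
have lin : linear (fun h => << a >> * (f * h) * << c >>).
  by move=> k h1 h2; rewrite !(mulrDl, mulrDr) !mul_malg_scaler -!scalerAl.
apply: (span_min (subspace_preimage lin Ssub)) (malg_span g).
by move=> _ [w _ <-] /=; rewrite mulrA -mulrA mul_wordE; apply: Jf.
Qed.

End FreeAlgebra.

(** * Right derivation *)

Section RightDerivative.
Variables (K : fieldType) (X : choiceType) (I : Type) (r : I -> free_alg K X).
Local Notation F := (free_alg K X).
Local Notation B := (pres_alg r).
Local Notation V := (X -> B).

Lemma pres_pi_linear : linear (@pres_pi K X I r).
Proof. by move=> k f g; rewrite pres_piD -pres_piZ; congr (_ + _). Qed.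

Lemma pres_pi_mul (f g : F) : pres_pi r (f * g) = pres_pi r f * pres_pi r g.
Proof. by rewrite -pres_piM. Qed.

Lemma pres_pi_ideal (f : F) : ideal_gen r f -> pres_pi r f = 0.
Proof.
by rewrite -(linear_fun0 pres_pi_linear) => Jf; apply/pres_piE; rewrite subr0.
Qed.

(** The vector [y] in the summand of [x]. The full product [X -> B] replaces the direct sum, which
    is harmless as only spans of given vectors are compared. *)
Definition at_gen (x : X) (y : B) : V := fun z => if z == x then y else 0.

Lemma at_gen_linear x : linear (at_gen x).
Proof.
move=> k y1 y2; apply/funext => z; rewrite /at_gen !fctE.
by case: ifP => // _; rewrite scaler0 addr0.
Qed.

Definition left_mul (y : B) (v : V) : V := fun x => y * v x.

Lemma left_mul_linear y : linear (left_mul y).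
Proof.
move=> k v1 v2; apply/funext => z.
by rewrite /left_mul !fctE mulrDr; congr (_ + _); rewrite -pres_scalerAr.
Qed.

Lemma left_mulr_linear v : linear (left_mul^~ v).
Proof.
move=> k y1 y2; apply/funext => z.
by rewrite /left_mul !fctE mulrDl; congr (_ + _); rewrite -pres_scalerAl.
Qed.

(** A word [u x] goes to the class of [u] in coordinate [x], and the empty word to 0. Reversal
    exposes the last letter. *)
Definition word_right_deriv (w : {fmonom X}) : V :=
  if rev w is x :: u then at_gen x (pres_pi r << FMonom (rev u) >>) else 0.

Definition right_deriv : F -> V := malg_lift word_right_deriv.

Lemma right_deriv_linear : linear right_deriv.
Proof. exact: malg_lift_linear. Qed.

Lemma right_deriv_mul_gen f x :
  right_deriv (f * << fmu x >>) = at_gen x (pres_pi r f).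
Proof.
have lin1 : linear (fun f => right_deriv (f * << fmu x >>)).
  by move=> k f1 f2; rewrite mull_malg_linear right_deriv_linear.
have lin2 : linear (fun f => at_gen x (pres_pi r f)).
  by move=> k f1 f2; rewrite pres_pi_linear at_gen_linear.
apply: (span_min (subspace_equalizer lin1 lin2)) (malg_span f).
move=> _ [w _ <-] /=; rewrite mul_wordE /right_deriv malg_liftU.
rewrite /word_right_deriv fmM fmU rev_cat /= revK.
by congr at_gen; congr (pres_pi r << _ >>); case: w.
Qed.

(** Left multiplication does not touch the last letter of a nonempty word. A constant term in [g]
    would contribute a multiple of the derivative of [f] on the left side only. *)
Lemma right_deriv_mul f g : 1%M \notin msupp g ->
  right_deriv (f * g) = left_mul (pres_pi r f) (right_deriv g).
Proof.
move=> g1.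
have lin1 : linear (fun g => right_deriv (f * g)).
  by move=> k g1' g2; rewrite mulr_malg_linear right_deriv_linear.
have lin2 : linear (fun g => left_mul (pres_pi r f) (right_deriv g)).
  by move=> k g1' g2; rewrite right_deriv_linear left_mul_linear.
apply: (span_min (subspace_equalizer lin1 lin2)) (malg_span g).
move=> _ [w wg <-] /=; have [w1|[w' [x ->]]] := fmonom_last w.
  by move: g1; rewrite -w1 wg.
rewrite -mul_wordE mulrA !right_deriv_mul_gen pres_pi_mul.
by apply/funext => z; rewrite /left_mul /at_gen; case: ifP; rewrite ?mulr0.
Qed.

End RightDerivative.

Arguments free_gr_word {K X} degX w.

(** * Exactness in the middle and comparison of dimensions *)

Lemma right_deriv_homogeneous_ideal (K : fieldType) (X : choiceType)
    (degX : X -> nat) (R : Type) (r : R -> free_alg K X) (degR : R -> nat)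
    (degR_gt0 : forall i, (0 < degR i)%N)
    (r_homog : forall i, free_gr degX (degR i)%:Z (r i))
    (n : int) (S : set (X -> pres_alg r)) (f : free_alg K X) :
  subspace S ->
  (forall i y, pres_gr r degX (n - (degR i)%:Z) y ->
    S (left_mul y (right_deriv r (r i)))) ->
  ideal_gen r f -> free_gr degX n f -> S (right_deriv r f).
Proof.
move=> Ssub Srel Jf Ff.
have lin : linear (fun f => right_deriv r (free_comp degX n f)).
  by move=> k f1 f2; rewrite free_comp_linear right_deriv_linear.
(* The products [a * r_i * c] that make up [f] may have any degree; projecting to degree [n]
   discards the others. *)
have -> : f = free_comp degX n f by rewrite (free_comp_gr n Ff) eqxx.
apply: (span_min (subspace_preimage lin Ssub)) (ideal_gen_span Jf).
move=> _ [a [i [c ->]]] /=.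
have Fa := @free_gr_word K X degX a; have Fc := @free_gr_word K X degX c.
have Farc := free_grM (free_grM Fa (r_homog i)) Fc.
rewrite (free_comp_gr n Farc); case: eqP => [nE|_]; last first.
  rewrite (linear_fun0 (right_deriv_linear r)).
  exact: (subspace0 Ssub).
have [c1|[c' [x c'x]]] := fmonom_last c.
  (* Since [r i] is homogeneous of positive degree, it has no constant term and the product rule
     applies. *)
  rewrite c1 -[<< 1%M >>]/(1 : free_alg K X) mulr1 right_deriv_mul; last first.
    apply/negP => /r_homog; rewrite wdeg1 => -[d0].
    by move: (degR_gt0 i); rewrite -d0.
  apply: Srel; exists << a >> => //.
  by move: Fa; rewrite -nE c1 wdeg1 addr0 addrK.
rewrite c'x -mul_wordE mulrA right_deriv_mul_gen pres_pi_ideal.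
  rewrite (linear_fun0 (at_gen_linear x)).
  exact: (subspace0 Ssub).
have [_ _ JM] := ideal_gen_two_sided r.
have Jr : ideal_gen r (r i) by move=> J [_]; apply; exists i.
have [Jar _] := JM << a >> _ Jr.
by have [_] := JM << c' >> _ Jar.
Qed.

(** Evaluation at coordinate [x] kills the members from other generators and turns a dependency into
    one inside [e x]. *)
Lemma at_gen_free (K : fieldType) (X : choiceType) (R : Type)
    (r : R -> free_alg K X) (T : X -> Type) (e : forall x, T x -> pres_alg r) :
  (forall x, free_family (e x)) ->
  free_family (fun l : {x : X & T x} => at_gen (projT1 l) (e _ (projT2 l))).
Proof.
move=> e_free [x t] /=; set S := span _ => St; apply: (e_free x t).
have lin : linear (fun v : X -> pres_alg r => v x) by move=> k v1 v2.
have Usub := subspace_preimage lin (span_subspace (e x @` [set t' | t' <> t])).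
have -> : e x t = at_gen x (e x t) x by rewrite /at_gen eqxx.
apply: (span_min Usub) St => _ [[x' t'] /= xt' <-].
rewrite /at_gen /=; case: eqP => [xx'|_]; last first.
  exact: (subspace0 (span_subspace _)).
by subst x'; apply: sub_span; exists t' => // tt'; apply: xt'; rewrite tt'.
Qed.

Theorem mainTheorem1 (K : fieldType)
    (X : choiceType) (degX : X -> nat) (degX_gt0 : forall x, (0 < degX x)%N)
    (R : Type) (r : R -> free_alg K X) (degR : R -> nat)
    (degR_gt0 : forall i, (0 < degR i)%N)
    (r_homog : forall i, free_gr degX (degR i)%:Z (r i))
    (b : int -> Type) (b_dim : forall n, has_dim (pres_gr r degX n) (b n))
    (n : int) :
  [set: {x : X & b (n - (degX x)%:Z)}] #<=
  [set: {i : R & b (n - (degR i)%:Z)} + b n].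
Proof.
have [e eP] : {e : forall n, b n -> pres_alg r & forall n,
    [/\ forall t, pres_gr r degX n (e n t), lin_indep (e n) &
        spans (e n) (pres_gr r degX n)]}.
  by exists (fun n => sval (cid (b_dim n))) => k; exact: (svalP (cid (b_dim k))).
(* Homogeneous lifts of the chosen basis vectors to the free algebra. *)
have [h hP] : {h : forall n, b n -> free_alg K X & forall n t,
    free_gr degX n (h n t) /\ pres_pi r (h n t) = e n t}.
  have ex k t : exists f, free_gr degX k f /\ pres_pi r f = e k t.
    by have [/(_ t)[f Ff fe] _ _] := eP k; exists f.
  by exists (fun k t => sval (cid (ex k t))) => k t; exact: (svalP (cid (ex k t))).
pose gen (l : {x : X & b (n - (degX x)%:Z)}) :=
  at_gen (projT1 l) (e _ (projT2 l)).
pose rel (t : {i : R & b (n - (degR i)%:Z)} + b n) := match t with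
  | inl l => left_mul (e _ (projT2 l)) (right_deriv r (r (projT1 l)))
  | inr t => right_deriv r (h n t)
  end.
apply: (free_family_card_le (e := gen) (s := rel)).
  apply: (at_gen_free (e := fun x => e (n - (degX x)%:Z))) => x.
  by have [_ e_indep _] := eP (n - (degX x)%:Z); apply: lin_indep_free_family.
move=> [x t]; have [Fh pih] := hP _ t; set S := span _.
have Ssub : subspace S by exact: span_subspace.
pose g := h _ t * << fmu x >>.
have -> : gen (existT _ x t) = right_deriv r g by rewrite right_deriv_mul_gen pih.
have Fg : free_gr degX n g.
  have := free_grM Fh (free_gr_word degX (fmu x)).
  by rewrite wdegU subrK.
(* Lifting the expansion of the class of [g] in the basis of degree [n] gives [k] with derivative in
   [S]. Then [g - k] is a homogeneous element of the ideal, to which exactness applies. *)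
have [k [Fk [pik Sk]]] : exists k,
    free_gr degX n k /\ pres_pi r k = pres_pi r g /\ S (right_deriv r k).
  have [_ _ e_span] := eP n.
  have /(spans_span e_span) : pres_gr r degX n (pres_pi r g) by exists g.
  have Fsub := free_gr_subspace K degX n.
  apply: (@span_min _ _ _ [set y | exists k,
      free_gr degX n k /\ pres_pi r k = y /\ S (right_deriv r k)]); last first.
    move=> _ [u _ <-]; have [Fu piu] := hP _ u; exists (h n u); do 2!split=> //.
    by apply: sub_span; exists (inr u).
  have pi0 := linear_fun0 (pres_pi_linear r).
  split=> [|_ _ [k1 [F1 [<- S1]]] [k2 [F2 [<- S2]]]|c _ [k1 [F1 [<- S1]]]].
  - exists 0; split; first exact: (subspace0 Fsub).
    split=> //; rewrite (linear_fun0 (right_deriv_linear r)).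
    exact: (subspace0 Ssub).
  - exists (k1 + k2); split; first exact: (subspaceD Fsub).
    split; first exact: pres_piD.
    by rewrite -[k1]scale1r right_deriv_linear scale1r; apply: (subspaceD Ssub).
  - exists (c *: k1); split; first exact: (subspaceZ Fsub).
    split; first by rewrite -[c *: k1]addr0 pres_pi_linear pi0 addr0.
    exact: (subspaceZ (subspace_preimage (right_deriv_linear r) Ssub)).
rewrite -[g](subrK k).
apply: (subspaceD (subspace_preimage (right_deriv_linear r) Ssub)) => //=.
apply: (right_deriv_homogeneous_ideal degR_gt0 r_homog Ssub).
(* By linearity in [y], only basis vectors need checking, and these give members of [rel]. *)
- move=> i y; have [_ _ e_span] := eP (n - (degR i)%:Z).
  move=> /(spans_span e_span).
  apply: (span_min (subspace_preimage (left_mulr_linear _) Ssub)).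
  by move=> _ [u _ <-]; apply: sub_span; exists (inl (existT _ i u)).
- exact/pres_piE.
- exact: (subspaceB (free_gr_subspace K degX n) Fg Fk).
Qed.
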